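(* Let $d\geqslant 4$ be an integer and let $n$ be a positive integer with $n\equiv -1\pmod{d}$. Then \[ \sum_{k=0}^{n-1}[2dk+1]\frac{(q;q^d)_k^d}{(q^d;q^d)_k^d}q^{\frac{d(d-3)k}{2}} \equiv 0\pmod{\Phi_n(q)^2\Phi_{dn-n}(q)}. \]
   Context: $q$ is an indeterminate. The $q$-shifted factorial is $(a;q)_k=(1-a)(1-aq)\cdots(1-aq^{k-1})$ (with $(a;q)_0=1$). For any integer $m$, $[m]=(1-q^m)/(1-q)$. $\Phi_m(q)$ denotes the $m$-th cyclotomic polynomial. A congruence of rational functions modulo a polynomial $P(q)$, where the denominators are coprime to $P(q)$, means that $P(q)$ divides the numerator of the difference in lowest terms. *)

(* Defs.v *)
From HB Require Import structures.
From mathcomp Require Import all_boot all_order all_algebra all_field.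
From mathcomp Require Import fraction.
Set Implicit Arguments. Unset Strict Implicit. Unset Printing Implicit Defensive.
Import Order.TTheory GRing.Theory Num.Theory.
Local Open Scope ring_scope.

Notation RF := {fraction {poly rat}}.

Notation "x %:F" := (@FracField.tofrac _ x) : ring_scope.

Definition qv : RF := ('X)%:F.

Definition qpoch (a b : RF) (k : nat) : RF := \prod_(i < k) (1 - a * b ^+ i).

Definition qint (m : nat) : RF := (1 - qv ^+ m) / (1 - qv).

Definition Phi (m : nat) : {poly rat} := map_poly intr ('Phi_m).

(* x ≡ 0 (mod P): x = N/D with D coprime to P and P dividing N
   (equivalently, P divides the numerator of x in lowest terms). *)
Definition congr0 (x : RF) (P : {poly rat}) : Prop :=
  exists N D : {poly rat},
    [/\ D != 0, coprimep D P, x = N%:F / D%:F & P %| N].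

(* Main.v *)
Require Import Defs.
From HB Require Import structures.
From mathcomp Require Import all_boot all_order all_algebra all_field.
From mathcomp Require Import fraction ring zify.
Import Order.TTheory GRing.Theory Num.Theory.
Local Open Scope ring_scope.

(** Put Q = q^d, n + 1 = d i and N = (d-1) i - 1, so that dN + 1 = (d-1) n. The
    summand is very-well-poised with base Q and all parameters equal to q, and
    modulo both cyclotomic factors it stops at k = N, since (q; Q)_k contains
    1 - q^((d-1)n) for k > N.

    Modulo Phi_n^2 one moves parameters q to q^(1 + b n), and the matching Q to
    q^(d - b n). With b = -(d-1) the series terminates at N, and its weights are
    the reciprocals of the products of differences of the nodes
    Q^(-k) + q Q^k. If the other shifts are suitably chosen, the remaining factor
    is a polynomial in the node of degree < N, so the shifted sum is a divided
    difference of order N, which is exactly 0. To first order in q^n - 1 the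
    shifts only enter through their sum. For d odd that sum can be made 0; for
    d even the first-order term vanishes because, at a primitive n-th root of
    unity, the summand is odd and its logarithmic derivative is even under
    k -> N - k. The same oddness, at a primitive (d-1)n-th root of unity,
    gives the factor Phi_{dn-n}. *)

Set Implicit Arguments.
Unset Strict Implicit.
Unset Printing Implicit Defensive.

(** * Shifted factorials and divided differences *)

Definition poch (K : fieldType) (a b : K) (k : nat) : K :=
  \prod_(i < k) (1 - a * b ^+ i).

Lemma pochS (K : fieldType) (a b : K) k :
  poch a b k.+1 = poch a b k * (1 - a * b ^+ k).
Proof. by rewrite /poch big_ord_recr. Qed.

Lemma pochD (K : fieldType) (a b : K) m k :
  poch a b (m + k) = poch a b m * poch (a * b ^+ m) b k.
Proof.
rewrite /poch big_split_ord /=; congr (_ * _).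
by apply: eq_bigr => i _; rewrite -mulrA exprD.
Qed.

Lemma prod_ord_neq (R : comPzRingType) (F : nat -> R) N r : (r <= N)%N ->
  \prod_(s < N.+1 | s != r :> nat) F s =
  (\prod_(s < r) F s) * \prod_(s < N - r) F (r.+1 + s)%N.
Proof.
move=> rN; rewrite -(big_mkord (fun s => s != r) F).
rewrite (@big_cat_nat _ _ _ r) //=; last by rewrite ltnW.
congr (_ * _).
  rewrite big_nat_cond (eq_bigl (fun s => (0 <= s < r)%N)); last first.
    by move=> s; lia.
  by rewrite -big_nat big_mkord.
rewrite big_ltn_cond ?ltnS //= eqxx /= big_nat_cond.
rewrite (eq_bigl (fun s => (r.+1 <= s < N.+1)%N)); last by move=> s; lia.
rewrite -big_nat -{1}[r.+1]add0n big_addn subSS big_mkord.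
by apply: eq_bigr => s _; rewrite addnC.
Qed.

(** Lagrange interpolation at N + 1 nodes reproduces [f]. Each basis polynomial has as
    X^N-coefficient the reciprocal of its product of node differences, while that of [f] is 0
    because deg f < N. *)
Lemma sum_divided_difference (K : fieldType) (y : nat -> K) N (f : {poly K}) :
  injective y -> (size f <= N)%N ->
  \sum_(r < N.+1) f.[y r] / \prod_(s < N.+1 | s != r :> nat) (y r - y s) = 0.
Proof.
move=> yI fN.
have := lagrange_gen (ltn0Sn N) yI (leq_trans fN (leqnSn N)).
move/(congr1 (fun p : {poly K} => p`_N)); rewrite nth_default // coef_sum => E.
rewrite [RHS]E.
apply: eq_bigr => r _; rewrite lagrangeE //= coefCM coefCM; congr (_ * _).
rewrite horner_prod [in RHS](eq_bigr (fun s : 'I_N.+1 => y r - y s)); last first.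
  by move=> s _; rewrite !hornerE.
suff -> : (\prod_(j < N.+1 | j != r) ('X - (y j)%:P))`_N = 1 by rewrite mulr1.
have /monicP : \prod_(j < N.+1 | j != r) ('X - (y j)%:P) \is monic.
  by apply: monic_prod => j _; rewrite monicXsubC.
rewrite lead_coefE -big_filter size_prod_XsubC size_filter -sum1_count.
by rewrite sum1_card cardC1 card_ord.
Qed.

(** * Very-well-poised weights as reciprocals of node differences *)

Section Nodes.
Variables (K : fieldType) (a Q : K).
Hypotheses (a0 : a != 0) (Q0 : Q != 0).
Hypothesis Qn1 : forall k, (0 < k)%N -> 1 - Q ^+ k != 0.
Hypothesis aQn1 : forall k, 1 - a * Q ^+ k != 0.

(** The q-quadratic lattice: 1/x + a x at x = Q^r, invariant under x -> 1/(a x). *)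
Definition wp_node r := Q ^- r + a * Q ^+ r.

Lemma wp_nodeB r s : wp_node r - wp_node s =
  - Q ^- s * (1 - Q ^- r * Q ^+ s) * (1 - a * Q ^+ r * Q ^+ s).
Proof.
rewrite /wp_node; have := expf_neq0 r Q0; have := expf_neq0 s Q0.
by move: (Q ^+ r) (Q ^+ s) => x y *; field; apply/andP.
Qed.

Lemma wp_node_inj : injective wp_node.
Proof.
suff H r s : (r < s)%N -> wp_node r != wp_node s.
  move=> r s E; case: (ltngtP r s) => // /H; first by rewrite E eqxx.
  by rewrite E eqxx.
move=> rs; rewrite -subr_eq0 wp_nodeB !mulf_neq0 ?oppr_eq0 ?invr_eq0 ?expf_neq0 //.
  rewrite -(subnKC (ltnW rs)) exprD mulrA mulVf ?expf_neq0 // mul1r.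
  by rewrite Qn1 // subn_gt0.
by rewrite -mulrA -exprD.
Qed.

(** Both (Q^(-N);Q)_r and (Q^(-r);Q)_r carry a sign (-1)^r and a binomial power of Q; in the product
    the signs cancel and the exponents combine to -(N+1) r. *)
Lemma poch_reverse N r : (r <= N)%N ->
  poch (Q ^- N) Q r * poch (Q ^- r) Q r * poch Q Q (N - r) * Q ^+ (N.+1 * r) =
  poch Q Q r * poch Q Q N.
Proof.
elim: r => [|r IH] rN; first by rewrite /poch !big_ord0 muln0 subn0 expr0; ring.
have := IH (ltnW rN); rewrite -(subnSK rN) (pochS Q Q r) (pochS (Q ^- N)) pochS.
have -> : poch (Q ^- r.+1) Q r.+1 = (1 - Q ^- r.+1) * poch (Q ^- r) Q r.
  rewrite -add1n pochD {1}/poch big_ord1 expr0 mulr1 expr1.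
  by rewrite exprS invfM mulrAC mulVf // mul1r.
rewrite mulnS exprD => E.
have -> : poch Q Q r * (1 - Q * Q ^+ r) * poch Q Q N =
  (poch Q Q r * poch Q Q N) * (1 - Q * Q ^+ r) by ring.
rewrite -{}E.
have -> : Q ^- N = Q ^- r * Q ^- (N - r.+1).+1.
  by rewrite -invfM -exprD subnSK // subnKC // ltnW.
have -> : Q ^+ N.+1 = Q * (Q ^+ r * Q ^+ (N - r.+1).+1).
  by rewrite -exprD subnSK // subnKC ?exprS // ltnW.
rewrite !exprS; have := expf_neq0 r Q0; have := expf_neq0 (N - r.+1) Q0.
by move: (Q ^+ r) (Q ^+ (N - r.+1)) (Q ^+ (_ * r)) => x y w *; field; do ?[apply/andP; split].
Qed.

Lemma poch_neq0 (b : K) r : (forall k, 1 - b * Q ^+ k != 0) -> poch b Q r != 0.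
Proof. by move=> h; apply/prodf_neq0 => k _; apply: h. Qed.

(** By [wp_nodeB] the product of differences splits into q-factorials. The right-hand side does not
    depend on r, so the weight is a constant times the reciprocal of that product. *)
Lemma wp_weight N r : (r <= N)%N ->
  (1 - a * Q ^+ (2 * r)) * poch a Q r * poch (Q ^- N) Q r
    / (poch Q Q r * poch (a * Q ^+ N.+1) Q r) * Q ^+ (N * r)
  * \prod_(s < N.+1 | s != r :> nat) (wp_node r - wp_node s) =
  - (\prod_(s < N.+1) (- Q ^- s)) * poch Q Q N * poch a Q N.+1.
Proof.
move=> rN.
rewrite (eq_bigr (fun s : 'I_N.+1 => - Q ^- s *
   ((1 - Q ^- r * Q ^+ s) * (1 - a * Q ^+ r * Q ^+ s)))); last first.
  by move=> s _; rewrite wp_nodeB mulrA.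
rewrite big_split /= big_split /= !(prod_ord_neq (fun s => 1 - _ * Q ^+ s)) //.
rewrite [in RHS](bigD1 (Ordinal (rN : r < N.+1)%N)) //=.
rewrite -[\prod_(s < r) (1 - Q ^- r * _)]/(poch (Q ^- r) Q r).
rewrite -[\prod_(s < r) (1 - a * _ * _)]/(poch (a * Q ^+ r) Q r).
have -> : \prod_(s < N - r) (1 - Q ^- r * Q ^+ (r.+1 + s)) = poch Q Q (N - r).
  apply: eq_bigr => s _; congr (1 - _).
  by rewrite addSnnS exprD mulKf ?expf_neq0 // exprS.
have -> : \prod_(s < N - r) (1 - a * Q ^+ r * Q ^+ (r.+1 + s)) =
          poch (a * Q ^+ r * Q ^+ r.+1) Q (N - r).
  by apply: eq_bigr => s _; rewrite exprD mulrA.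
(* Both sides are (a;Q)_(N+1+r). The factor 1 - a Q^(2r), lost from the difference product by the
   condition s != r, is restored by the very-well-poised factor. *)
have E1 : poch a Q N.+1 * poch (a * Q ^+ N.+1) Q r =
          poch a Q r * (poch (a * Q ^+ r) Q r * (1 - a * Q ^+ (2 * r)) *
                        poch (a * Q ^+ r * Q ^+ r.+1) Q (N - r)).
  have -> : 1 - a * Q ^+ (2 * r) = 1 - a * Q ^+ r * Q ^+ r.
    by rewrite mul2n -addnn exprD mulrA.
  rewrite -pochS -!pochD; congr (poch _ _ _).
  by lia.
have E2 := poch_reverse rN.
have p1 : poch Q Q r != 0 by apply: poch_neq0 => k; rewrite -exprS Qn1.
have p2 : poch (a * Q ^+ N.+1) Q r != 0.
  by apply: poch_neq0 => k; rewrite -mulrA -exprD.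
have Er : Q ^+ (N.+1 * r) = Q ^+ (N * r) * Q ^+ r by rewrite mulSn addnC exprD.
rewrite {}Er in E2.
have Qr := expf_neq0 r Q0.
have {E1} -> : poch a Q N.+1 = poch a Q r * (poch (a * Q ^+ r) Q r *
   (1 - a * Q ^+ (2 * r)) * poch (a * Q ^+ r * Q ^+ r.+1) Q (N - r)) /
    poch (a * Q ^+ N.+1) Q r by rewrite -E1 mulfK.
have {E2} -> : poch Q Q N = poch (Q ^- N) Q r * poch (Q ^- r) Q r *
   poch Q Q (N - r) * (Q ^+ (N * r) * Q ^+ r) / poch Q Q r.
  by rewrite E2 mulrC mulKf.
rewrite (eq_bigl (fun s : 'I_N.+1 => s != r :> nat)) //.
move: p1 p2; set A := poch Q Q r; set B := poch (a * Q ^+ N.+1) Q r.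
clearbody A B => A0 B0.
move: (poch _ _ _) (poch _ _ _) (poch _ _ _) (poch _ _ _) (poch _ _ _) => C D E F G.
set P := \prod_(_ < _ | _) _; clearbody P.
move: Qr; move: (1 - a * _) (Q ^+ (N * r)) (Q ^+ r) => J L M M0.
by field; rewrite ?A0 ?B0 ?M0.
Qed.

Lemma wp_sum_poly N (f : {poly K}) : (size f <= N)%N ->
  \sum_(r < N.+1) (1 - a * Q ^+ (2 * r)) * poch a Q r * poch (Q ^- N) Q r
    / (poch Q Q r * poch (a * Q ^+ N.+1) Q r) * Q ^+ (N * r) * f.[wp_node r] = 0.
Proof.
move=> fN; set C := - (\prod_(s < N.+1) (- Q ^- s)) * poch Q Q N * poch a Q N.+1.
rewrite (eq_bigr (fun r : 'I_N.+1 => C *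
   (f.[wp_node r] / \prod_(s < N.+1 | s != r :> nat) (wp_node r - wp_node s)))).
  by rewrite -mulr_sumr sum_divided_difference ?mulr0 //; apply: wp_node_inj.
move=> r _; rewrite /C -(wp_weight (leq_ord r)).
set D := \prod_(s < N.+1 | _) _; have D0 : D != 0.
  apply/prodf_neq0 => s; apply: contraNneq => /eqP.
  by rewrite subr_eq0 => /eqP/wp_node_inj->.
by rewrite [X in _ = X]mulrAC [in RHS]mulrA mulfVK // mulrC.
Qed.

(** First (x Q^M;Q)_r / (x;Q)_r = (x Q^r;Q)_M / (x;Q)_M. Then factor j of (b Q^r;Q)_M is paired with
    factor M-1-j of (c Q^r;Q)_M: as b c Q^(M-1) = a, their product with x = Q^r is 1 - u_j x + a
    x^2, which is x times (node - u_j). *)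
Lemma wp_pair_poly (b c : K) M : b * c * Q ^+ M = a * Q ->
  (forall k, 1 - b * Q ^+ k != 0) -> (forall k, 1 - c * Q ^+ k != 0) ->
  exists2 f : {poly K}, (size f <= M.+1)%N & forall r,
    poch (c * Q ^+ M) Q r * poch (b * Q ^+ M) Q r / (poch b Q r * poch c Q r)
      * Q ^- (M * r) = f.[wp_node r].
Proof.
move=> bcM b0 c0; pose u j := b * Q ^+ j + c * Q ^+ (M - j.+1).
exists ((poch b Q M * poch c Q M)^-1 *: \prod_(j < M) ('X - (u j)%:P)).
  by rewrite (leq_trans (size_scale_leq _ _)) // 
   -(big_mkord xpredT (fun j => 'X - (u j)%:P)) size_prod_XsubC size_iota subn0.
move=> r; rewrite hornerZ horner_prod.
have shift x : (forall k, 1 - x * Q ^+ k != 0) ->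
    poch (x * Q ^+ M) Q r = poch x Q r * poch (x * Q ^+ r) Q M / poch x Q M.
  by move=> x0; rewrite -pochD addnC pochD [RHS]mulrC mulKf ?poch_neq0.
rewrite (shift b) // (shift c) //.
have E : poch (b * Q ^+ r) Q M * poch (c * Q ^+ r) Q M =
         Q ^+ (M * r) * \prod_(j < M) ('X - (u j)%:P).[wp_node r].
  rewrite mulnC exprM -[in Q ^+ r ^+ _](card_ord M) -prodr_const.
  rewrite [poch (c * _) _ _](reindex_inj rev_ord_inj) /= -!big_split /=.
  apply: eq_bigr => j _; rewrite !hornerE /u /wp_node.
  have aE : a = (b * Q ^+ j) * (c * Q ^+ (M - j.+1)).
    apply: (mulIf Q0); rewrite -bcM -[in LHS](subnKC (ltn_ord j)) addSnnS exprD exprSr; ring.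
  rewrite {}aE; have := expf_neq0 r Q0.
  by move: (Q ^+ r) (Q ^+ j) (Q ^+ _) => x y z ?; field.
have pb := poch_neq0 M b0; have pc := poch_neq0 M c0.
have pbr := poch_neq0 r b0; have pcr := poch_neq0 r c0.
have := expf_neq0 (M * r) Q0.
move: E; move: (\prod_(_ < _) _) => P E x0.
have -> : P = poch (b * Q ^+ r) Q M * poch (c * Q ^+ r) Q M / Q ^+ (M * r).
  by rewrite E mulrC mulKf.
by field; rewrite ?pb ?pc ?pbr ?pcr ?x0.
Qed.
End Nodes.

(** * Vanishing of the series with shifted parameters *)

Lemma expzXn (K : fieldType) (x : K) (m : int) h : (x ^ m) ^+ h = x ^ (m * h).
Proof. by rewrite exprnP exprz_exp. Qed.

Section Terminating.
Variables (K : fieldType) (q : K).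
Hypotheses (q0 : q != 0) (qn1 : forall m : int, m != 0 -> 1 - q ^ m != 0).
Variables (d n i : nat).
Hypotheses (d2 : (1 < d)%N) (i0 : (0 < i)%N) (ni : n.+1 = (d * i)%N).

(* The contribution of one parameter, shifted from q to q^(1 + b n); the last factor
   records how the argument of the series depends on the parameter. *)
Definition wp_ratio (b : int) r : K :=
  poch (q ^ (1 + b * n)) (q ^+ d) r / poch (q ^ (d%:Z - b * n)) (q ^+ d) r
  * q ^ (- (b * n * r)).

Definition wp_last := ((d - 1) * i - 1)%N.

Lemma expzM_base (m : int) k : q ^ m * q ^+ d ^+ k = q ^ (m + d%:Z * k).
Proof. by rewrite -exprM expfzDr // -PoszM. Qed.

Lemma base_shift_neq0 (m : int) : (forall k : nat, m + d%:Z * k != 0) ->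
  forall k, 1 - q ^ m * q ^+ d ^+ k != 0.
Proof. by move=> h k; rewrite expzM_base qn1. Qed.

Lemma base_neq0 k : (0 < k)%N -> 1 - q ^+ d ^+ k != 0.
Proof. by move=> k0; rewrite -exprM (qn1 (m := (d * k)%N)) //; nia. Qed.

(** The case a = q of [wp_sum_poly]. Since (d-1) n = dN + 1, the shift -(d-1) turns q into Q^(-N)
    and Q into q Q^(N+1); its last factor is Q^(N r) q^r, whence the compensating [q ^- r]. *)
Lemma wp_terminating_sum (F : {poly K}) : (size F <= wp_last)%N ->
  \sum_(r < wp_last.+1) (1 - q ^+ (2 * d * r + 1)) * wp_ratio 0 r
     * wp_ratio (- (d - 1)%N%:Z) r * q ^- r * F.[wp_node q (q ^+ d) r] = 0.
Proof.
move=> FN; have Q0 : q ^+ d != 0 by rewrite expf_neq0.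
have qQ k : 1 - q * q ^+ d ^+ k != 0.
  by rewrite -exprM -exprS (qn1 (m := (d * k).+1)).
rewrite -[RHS](wp_sum_poly q0 Q0 base_neq0 qQ FN).
apply: eq_bigr => r _; congr (_ * _).
have Nn : (d * wp_last + 1 = (d - 1) * n)%N by rewrite /wp_last; nia.
rewrite /wp_ratio mul0r addr0 subr0 !mul0r oppr0 mulr1.
rewrite -exprM -exprS mulrA [(d * _)%N]mulnCA.
have -> : q ^ (1 + - (d - 1)%N%:Z * n) = q ^+ d ^- wp_last.
  by rewrite -exprM exprnN; congr (_ ^ _); nia.
have -> : q ^ (d%:Z - - (d - 1)%N%:Z * n) = q * q ^+ d ^+ wp_last.+1.
  by rewrite -exprM -exprS; rewrite exprnP; congr (_ ^ _); nia.
have -> : q ^ (- (- (d - 1)%N%:Z * n * r)) = q ^+ d ^+ (wp_last * r) * q ^+ r.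
  by rewrite -exprM -exprD; rewrite exprnP; congr (_ ^ _); nia.
have := expf_neq0 r q0.
rewrite addn1 !expr1z -[q ^ d]/(q ^+ d) invfM -mulnA.
by move=> r0; rewrite (mulrA _ _ (q ^+ r)) mulfK //; ring.
Qed.

Lemma intdvd_shift_neq0 (x : nat) (y : int) : (0 < x < d)%N -> x%:Z + d%:Z * y != 0.
Proof.
move=> /andP[x0 xd]; apply/eqP => E; have [y0|y0] : y <= -1 \/ 0 <= y by lia.
  by nia.
by nia.
Qed.

Lemma wp_ratio_poly (b c : int) M : b + c = 1 + d%:Z * M.+1 ->
    (forall k : nat, b - d%:Z * M + d%:Z * k != 0) ->
    (forall k : nat, c - d%:Z * M + d%:Z * k != 0) ->
  exists2 f : {poly K}, (size f <= M.+1)%N & forall r,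
    poch (q ^ c) (q ^+ d) r * poch (q ^ b) (q ^+ d) r
    / (poch (q ^ (b - d%:Z * M)) (q ^+ d) r * poch (q ^ (c - d%:Z * M)) (q ^+ d) r)
    = f.[wp_node q (q ^+ d) r] * q ^ (d%:Z * M * r).
Proof.
move=> bc b0 c0; have Q0 : q ^+ d != 0 by rewrite expf_neq0.
have [|||f fM fE] := @wp_pair_poly _ q _ Q0 (q ^ (b - d%:Z * M)) (q ^ (c - d%:Z * M)) M.
- by rewrite -expfzDr // expzM_base -exprS exprnP; congr (_ ^ _); nia.
- exact: base_shift_neq0.
- exact: base_shift_neq0.
exists f => // r; rewrite -fE !expzM_base !subrK -exprM exprnP mulnA mulfVK //.
by rewrite expf_neq0.
Qed.

(** Because n + 1 = d i, q = Q^(i-1) q^(d-n) and q^(1+n) = Q^(i-1) Q: the numerator parameters of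
    the two ratios are those of the denominators times Q^M with M = i - 1. *)
Lemma wp_ratio_pair : exists2 f : {poly K}, (size f <= i)%N & forall r,
  wp_ratio 0 r * wp_ratio 1 r = f.[wp_node q (q ^+ d) r] * q ^ ((1 - d%:Z) * r).
Proof.
have nE : n%:Z = d%:Z * i - 1 by rewrite -PoszM -ni; lia.
have iE : (i - 1)%N%:Z = i%:Z - 1 by lia.
have [|k|k|f fi fE] := @wp_ratio_poly 1 (1 + n%:Z) (i - 1).
- by rewrite nE subn1 prednK //; ring.
- have -> : 1 - d%:Z * (i - 1)%N + d%:Z * k = 1%N%:Z + d%:Z * (k%:Z - (i%:Z - 1)).
    by rewrite iE; ring.
  exact: intdvd_shift_neq0.
- have -> : 1 + n%:Z - d%:Z * (i - 1)%N + d%:Z * k = (d * k.+1)%N%:Z.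
    by rewrite iE nE; lia.
  by nia.
exists f => [|r]; first by move: fi; rewrite subn1 prednK.
have -> : q ^ ((1 - d%:Z) * r) = q ^ (d%:Z * (i - 1)%N * r) * q ^ (- (n%:Z * r)).
  by rewrite -expfzDr //; congr (_ ^ _); nia.
rewrite [RHS]mulrA -fE /wp_ratio !mul0r !mul1r oppr0 addr0 subr0 mulr1.
have -> : 1 - d%:Z * (i - 1)%N = d%:Z - n%:Z by rewrite iE nE; ring.
have -> : 1 + n%:Z - d%:Z * (i - 1)%N = d%:Z by rewrite iE nE; ring.
by rewrite invfM; ring.
Qed.

(** A factor (q^e;Q)_r is inserted above and below. With M = e i - 1 and 2 e = d + 1, one has
    q^(1+en) = Q^M q^e and q^e = Q^M q^(d-en), as the pairing requires. *)
Lemma wp_ratio_half e : (2 * e = d.+1)%N ->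
  exists2 f : {poly K}, (size f <= e * i)%N & forall r,
  wp_ratio e r = f.[wp_node q (q ^+ d) r] * q ^ ((1 - e%:Z) * r).
Proof.
move=> ed; have ei0 : (0 < e * i)%N by nia.
have nE : n%:Z = d%:Z * i - 1 by rewrite -PoszM -ni; lia.
have eE : (e * i - 1)%N%:Z = e%:Z * i - 1 by lia.
have dE : d%:Z = 2 * e%:Z - 1 by lia.
have [|k|k|f fi fE] := @wp_ratio_poly (1 + e%:Z * n) e (e * i - 1).
- by rewrite nE subn1 prednK // PoszM dE; ring.
- have -> : 1 + e%:Z * n - d%:Z * (e * i - 1)%N + d%:Z * k = e%:Z + d%:Z * k.
    by rewrite eE nE dE; ring.
  by apply: intdvd_shift_neq0; lia.
- have -> : e%:Z - d%:Z * (e * i - 1)%N + d%:Z * k = e%:Z + d%:Z * (k%:Z - (e * i - 1)%N%:Z).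
    by ring.
  by apply: intdvd_shift_neq0; lia.
exists f => [|r]; first by move: fi; rewrite subn1 prednK.
have -> : q ^ ((1 - e%:Z) * r) = q ^ (d%:Z * (e * i - 1)%N * r) * q ^ (- (e%:Z * n * r)).
  by rewrite -expfzDr //; congr (_ ^ _); nia.
rewrite [RHS]mulrA -fE /wp_ratio.
have -> : e%:Z - d%:Z * (e * i - 1)%N = d%:Z - e%:Z * n.
  by rewrite eE nE dE; ring.
have -> : 1 + e%:Z * n - d%:Z * (e * i - 1)%N = e%:Z.
  by rewrite eE nE dE; ring.
have p0 : poch (q ^ e) (q ^+ d) r != 0.
  apply: poch_neq0; apply: base_shift_neq0 => k.
  by apply: intdvd_shift_neq0; lia.
by rewrite -mulf_div divff // mul1r.
Qed.

(* The d - 1 movable parameters have shifts -(d-1), 1 (h times) and 0 (h times). *)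
Lemma wp_sum_even h : (0 < h)%N -> d = (2 * h + 2)%N ->
  \sum_(r < wp_last.+1) (1 - q ^+ (2 * d * r + 1)) * q ^+ ((d * (d - 3) * r)./2) *
    (wp_ratio 0 r ^+ h.+1 * wp_ratio 1 r ^+ h * wp_ratio (- (d - 1)%N%:Z) r) = 0.
Proof.
move=> h0 dh; have [f fi fE] := wp_ratio_pair.
rewrite -[RHS](@wp_terminating_sum (f ^+ h)); last first.
  by apply: leq_trans (size_poly_exp_leq f h) _; rewrite /wp_last; nia.
apply: eq_bigr => r _; rewrite horner_exp.
(* This is where the weight d(d-3)/2 is forced: h (1-d) + d(d-3)/2 = -1. *)
have -> : q ^- r = (q ^ ((1 - d%:Z) * r)) ^+ h * q ^+ ((d * (d - 3) * r)./2).
  have -> : (d * (d - 3) * r)./2 = ((h + 1) * (2 * h - 1) * r)%N by rewrite dh; nia.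
  rewrite expzXn exprnN !exprnP -expfzDr //; congr (_ ^ _).
  by rewrite dh; nia.
by rewrite exprS -[_ * _ * wp_ratio 1 r ^+ h]mulrA -exprMn fE exprMn; ring.
Qed.

(* The shift h + 2 = (d+1)/2 is added: pairing it with the invisible parameter
   c = q^((d+1)/2), for which c^2 = q Q, again produces a polynomial in the node. *)
Lemma wp_sum_odd h : (0 < h)%N -> d = (2 * h + 3)%N ->
  \sum_(r < wp_last.+1) (1 - q ^+ (2 * d * r + 1)) * q ^+ ((d * (d - 3) * r)./2) *
    (wp_ratio 0 r ^+ h.+1 * wp_ratio 1 r ^+ h * wp_ratio h.+2 r
     * wp_ratio (- (d - 1)%N%:Z) r) = 0.
Proof.
move=> h0 dh; have [f fi fE] := wp_ratio_pair.
have [|g gi gE] := @wp_ratio_half h.+2; first by lia.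
rewrite -[RHS](@wp_terminating_sum (f ^+ h * g)); last first.
  (* The degree is at most h (i-1) + (h+2) i - 1 = N - h, which is below N only because h > 0. *)
  apply: leq_trans (size_polyMleq _ _) _.
  have := size_poly_exp_leq f h; rewrite /wp_last; nia.
apply: eq_bigr => r _; rewrite hornerM horner_exp.
have -> : q ^- r = (q ^ ((1 - d%:Z) * r)) ^+ h * q ^ ((1 - h.+2%:Z) * r)
                   * q ^+ ((d * (d - 3) * r)./2).
  have -> : (d * (d - 3) * r)./2 = ((2 * h + 3) * h * r)%N by rewrite dh; nia.
  rewrite expzXn exprnN !exprnP -!expfzDr //; congr (_ ^ _).
  by rewrite dh; nia.
by rewrite exprS -[_ * _ * wp_ratio 1 r ^+ h]mulrA -exprMn fE gE exprMn; ring.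
Qed.
End Terminating.

(* The summand without its factor 1 / (1 - q); here g stands for d (d - 3) / 2. *)
Definition wp_value (K : fieldType) (z : K) (d g r : nat) : K :=
  (1 - z ^+ (2 * d * r + 1)) *
  (poch z (z ^+ d) r / poch (z ^+ d) (z ^+ d) r) ^+ d * z ^+ (g * r).

(* The derivative of wp_ratio with respect to b, in units of q^n - 1, relative to
   its value at b = 0. *)
Definition wp_slope (K : fieldType) (z : K) (d r : nat) : K := \sum_(j < r)
  - (z ^ (1 + d%:Z * j) / (1 - z ^ (1 + d%:Z * j))
     + z ^ (d%:Z + d%:Z * j) / (1 - z ^ (d%:Z + d%:Z * j)) + 1).

Lemma bin2_double k : ('C(k.+1, 2) * 2 = k.+1 * k)%N.
Proof. by have := mul_bin_diag k.+1 1; rewrite bin1 /=; lia. Qed.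

(** * The symmetry r -> N - r at a root of unity *)

Section Reversal.
Variables (K : numFieldType) (z : K) (d g N : nat).
Hypotheses (z0 : z != 0) (zN : z ^+ (d * N + 1) = 1) (gd : (2 * g + 3 * d = d * d)%N).
(* Automatic at a primitive (dN + 1)-th root of unity, and for d even. *)
Hypothesis zS : (-1) ^+ (d * N) = z ^+ 'C(d * N + 2, 2).
Hypothesis zd1 : forall k, (0 < k <= N)%N -> 1 - z ^+ d ^+ k != 0.

Local Notation Q := (z ^+ d).
Local Notation wp_value := (wp_value z d g).
Local Notation wp_slope := (wp_slope z d).
Local Notation c r := (poch z Q r / poch Q Q r).

(** The source of the symmetry: reversal exchanges the factors of (z;Q) and (Q;Q) up to inversion of
    the q-powers. *)
Lemma root_shiftE k l : (k + l = N)%N -> z * Q ^+ k * Q ^+ l = 1.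
Proof. by move=> kl; rewrite -mulrA -exprD -exprM kl -exprS -addn1. Qed.

Lemma poch_negative (b : K) r : b != 0 ->
  poch (b ^- r) b r = (-1) ^+ r * b ^- 'C(r.+1, 2) * poch b b r.
Proof.
move=> b0; elim: r => [|r IH]; first by rewrite /poch !big_ord0 bin_small // invr1 !mulr1.
have -> : poch (b ^- r.+1) b r.+1 = (1 - b ^- r.+1) * poch (b ^- r) b r.
  rewrite -[r.+1 in LHS]add1n pochD {1}/poch big_ord1 expr0 mulr1 expr1.
  by rewrite exprS invfM mulrAC mulVf // mul1r.
rewrite pochS IH (binS r.+1) bin1 exprD !exprS.
have := expf_neq0 r b0; have := expf_neq0 'C(r.+1, 2) b0.
move: (b ^+ r) (b ^+ 'C(r.+1, 2)) => x y y0 x0; field.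
by rewrite b0 x0 y0.
Qed.

Lemma shift_neq0 k : (k < N)%N -> 1 - z * Q ^+ k != 0.
Proof.
move=> kN; have kNE : (k + (N - k))%N = N by rewrite subnKC // ltnW.
apply: contraNneq (zd1 (k := N - k) _); last by rewrite subn_gt0 kN leq_subr.
move/eqP; rewrite subr_eq0 => /eqP E.
by have := root_shiftE kNE; rewrite -E mul1r => ->; rewrite subrr.
Qed.

Lemma ratio_reverse r : (r <= N)%N -> c (N - r) = c N * (Q / z) ^+ r * c r.
Proof.
have Q0 : Q != 0 by rewrite expf_neq0.
elim: r => [|r IH] rN; first by rewrite subn0 /poch !big_ord0 divr1 !mulr1.
have := IH (ltnW rN); rewrite -(subnSK rN) !pochS.
set m := (N - r.+1)%N.
have n1 : 1 - z * Q ^+ m != 0 by apply: shift_neq0; rewrite /m; lia.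
have n2 : 1 - Q * Q ^+ m != 0 by rewrite -exprS; apply: zd1; rewrite /m; lia.
have n3 : 1 - z * Q ^+ r != 0 by apply: shift_neq0.
have n4 : 1 - Q * Q ^+ r != 0 by rewrite -exprS; apply: zd1; lia.
have n5 : poch Q Q m != 0.
  by apply/prodf_neq0 => k _; rewrite -exprS; apply: zd1; have := ltn_ord k; rewrite /m; lia.
have n6 : poch Q Q r != 0.
  by apply/prodf_neq0 => k _; rewrite -exprS; apply: zd1; have := ltn_ord k; lia.
have E : z * Q ^+ r * (Q * Q ^+ m) = 1.
  by rewrite -exprS root_shiftE // /m; lia.
have x0 := expf_neq0 r Q0.
have Em : Q ^+ m = (z * Q ^+ r * Q)^-1.
  apply: (mulfI (mulf_neq0 (mulf_neq0 z0 x0) Q0)).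
  by rewrite -mulrA E mulfV // !mulf_neq0.
move=> H.
have -> : poch z Q m / poch Q Q m = 
   poch z Q m * (1 - z * Q ^+ m) / (poch Q Q m * (1 - Q * Q ^+ m))
   * ((1 - Q * Q ^+ m) / (1 - z * Q ^+ m)).
  by field; rewrite n1 n2 n5.
rewrite {}H exprSr -!mulrA; congr (_ * (_ * _)).
rewrite {}Em in n1 n2 *; move: (poch z Q r) => p; move: x0 n3 n4 n1 n2.
move: (Q ^+ r) => x x0 n3 n4 n1 n2.
field; rewrite ?n6 ?x0 ?Q0 ?z0 ?n3 ?n4 ?n1 ?n2 /=.
by rewrite mulrC -oppr_eq0 opprB.
Qed.

Lemma wp_value_reverse r : (r <= N)%N -> wp_value (N - r) = - wp_value r.
Proof.
move=> rN; rewrite /wp_value ratio_reverse // -[RHS]mulNr.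
have Q0 : Q != 0 by rewrite expf_neq0.
have cN : c N = (-1) ^+ N * Q ^- 'C(N.+1, 2).
  have QzN : z = Q ^- N.
    by apply: (mulIf (expf_neq0 N Q0)); rewrite mulVf ?expf_neq0 // -(@root_shiftE 0 N) // mulr1.
  rewrite [X in poch X]QzN poch_negative // mulfK //.
  apply/prodf_neq0 => k _; rewrite -exprS; apply: zd1.
  by have := ltn_ord k; lia.
have E1 : 1 - z ^+ (2 * d * (N - r) + 1) =
    - z ^ (- (1 + 2 * d%:Z * r)) * (1 - z ^+ (2 * d * r + 1)).
  have -> : z ^+ (2 * d * (N - r) + 1) = z ^ (- (1 + 2 * d%:Z * r)) * z ^+ (d * N + 1) ^+ 2.
    rewrite -exprM !exprnP -expfzDr //; congr (_ ^ _); nia.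
  rewrite zN expr1n mulr1 mulrBr mulNr mulr1 mulNr opprK addrC.
  congr (_ + _); rewrite exprnP -expfzDr //.
  by have -> : - (1 + 2 * d%:Z * r) + (2 * d * r + 1)%N = 0 by lia.
have C1 := bin2_double N.
have C2 : ('C(d * N + 2, 2) * 2 = (d * N + 2) * (d * N + 1))%N.
  by rewrite addn2 addn1 bin2_double.
(* The constant left once the r-dependence is matched. [zS] replaces the sign (-1)^(dN) by a power
   of z, and 2g = d^2 - 3d makes the total exponent 0. *)
have E2 : c N ^+ d * z ^ (g%:Z * N - 1) = 1.
  rewrite cN exprMn [(-1) ^+ N ^+ d]exprAC -[in (-1) ^+ d ^+ N]exprM zS.
  rewrite exprVn -!exprM exprnN exprnP -!expfzDr //.
  by apply: (etrans (y := z ^ (0 : int))) => //; congr (_ ^ _); nia.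
have E3 : (Q / z) ^+ r ^+ d * z ^+ (g * (N - r)) =
  z ^ (g%:Z * N + 2 * d%:Z * r) * z ^+ (g * r).
  have -> : Q / z = z ^ (d%:Z - 1) by rewrite expfzDr.
  rewrite -exprM expzXn !exprnP -!expfzDr //; congr (_ ^ _); nia.
rewrite {}E1 2!exprMn.
have -> : z ^ (- (1 + 2 * d%:Z * r)) =
   z ^ (g%:Z * N - 1) / z ^ (g%:Z * N + 2 * d%:Z * r).
  by rewrite invr_expz -expfzDr //; congr (_ ^ _); ring.
have y0 : z ^ (g%:Z * N + 2 * d%:Z * r) != 0 by rewrite expfz_neq0.
set u := _ / z ^ _; set A := 1 - _; set B := c r ^+ d.
have -> : - u * A * (c N ^+ d * (Q / z) ^+ r ^+ d * B) * z ^+ (g * (N - r)) =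
  - u * A * B * c N ^+ d * ((Q / z) ^+ r ^+ d * z ^+ (g * (N - r))) by ring.
rewrite {}E3 -[RHS]mulr1 -{}E2 {}/u; move: y0.
move: (z ^ (_ + _)) (z ^ _) (c N ^+ d) => x y w x0.
by field.
Qed.

(** If x v = 1 then x/(1-x) + v/(1-v) = -1, so the increments at k and N-1-k are opposite. Hence the
    slope at N - k is the slope at N plus the slope at k, and k = N forces the slope at N to be
    0. *)
Lemma wp_slope_reverse r : (r <= N)%N -> wp_slope (N - r) = wp_slope r.
Proof.
have slopeS k : wp_slope k.+1 - wp_slope k = - (z * Q ^+ k / (1 - z * Q ^+ k)
     + Q ^+ k.+1 / (1 - Q ^+ k.+1) + 1).
  rewrite /wp_slope big_ord_recr /= addrAC subrr add0r.
  by rewrite -!exprM mulnS exprD !exprnP !expfzDr // expr1z PoszM.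
have slopeN k l : (k + l).+1 = N ->
    wp_slope k.+1 - wp_slope k = wp_slope l - wp_slope l.+1.
  move=> kl; rewrite slopeS -[RHS]opprB slopeS opprK.
  have n1 : 1 - z * Q ^+ k != 0 by apply: shift_neq0; lia.
  have n2 : 1 - z * Q ^+ l != 0 by apply: shift_neq0; lia.
  have n3 : 1 - Q ^+ k.+1 != 0 by apply: zd1; lia.
  have n4 : 1 - Q ^+ l.+1 != 0 by apply: zd1; lia.
  have E1 : z * Q ^+ k * Q ^+ l.+1 = 1 by apply: root_shiftE; lia.
  have E2 : z * Q ^+ l * Q ^+ k.+1 = 1 by apply: root_shiftE; lia.
  move: n1 n2 n3 n4 E1 E2.
  move: (z * Q ^+ k) (z * Q ^+ l) (Q ^+ k.+1) (Q ^+ l.+1) => x y u v x1 y1 u1 v1 E1 E2.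
  apply/eqP; rewrite -subr_eq0; apply/eqP.
  have -> : - (x / (1 - x) + u / (1 - u) + 1) - (y / (1 - y) + v / (1 - v) + 1) =
     (x * v - 1) / ((1 - x) * (1 - v)) + (y * u - 1) / ((1 - y) * (1 - u)).
    by field; rewrite ?x1 ?y1 ?u1 ?v1.
  by rewrite E1 E2 subrr !mul0r addr0.
have slope0 : wp_slope 0 = 0 by rewrite /wp_slope big_ord0.
suff H k : (k <= N)%N -> wp_slope (N - k) = wp_slope N + wp_slope k.
  move=> rN; rewrite H //; suff -> : wp_slope N = 0 by rewrite add0r.
  have := H N (leqnn N); rewrite subnn slope0 -mulr2n => /esym/eqP.
  by rewrite mulrn_eq0 => /eqP.
elim: k => [|k IH] kN; first by rewrite subn0 slope0 addr0.
have := IH (ltnW kN); rewrite -(subnSK kN) => E.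
have : wp_slope k.+1 - wp_slope k = _ := slopeN k (N - k.+1)%N ltac:(lia).
by rewrite {}E => /(canRL (subrK _)) ->; ring.
Qed.

Lemma wp_value_sum : \sum_(r < N.+1) wp_value r = 0.
Proof.
set S := LHS; suff : S = - S by move/eqP; rewrite -addr_eq0 -mulr2n mulrn_eq0 => /eqP.
rewrite -sumrN /S (reindex_inj rev_ord_inj); apply: eq_bigr => r _ /=.
by rewrite subSS wp_value_reverse // leq_ord.
Qed.

Lemma wp_value_slope_sum : \sum_(r < N.+1) wp_value r * wp_slope r = 0.
Proof.
set S := LHS; suff : S = - S by move/eqP; rewrite -addr_eq0 -mulr2n mulrn_eq0 => /eqP.
rewrite -sumrN /S (reindex_inj rev_ord_inj); apply: eq_bigr => r _ /=.
by rewrite subSS wp_value_reverse ?leq_ord // wp_slope_reverse ?leq_ord // mulNr.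
Qed.
End Reversal.

(** * Rational functions regular at z and their first-order expansions *)

Section Evaluation.
Variable z : algC.

Definition ratpoly_eval (p : {poly rat}) : algC := (map_poly ratr p).[z].

(* x is regular at z, with value y. *)
Definition evals (x : RF) (y : algC) : Prop :=
  exists N D : {poly rat}, [/\ ratpoly_eval D != 0, x = N%:F / D%:F
    & y = ratpoly_eval N / ratpoly_eval D].

Lemma ratpoly_evalD p q : ratpoly_eval (p + q) = ratpoly_eval p + ratpoly_eval q.
Proof. by rewrite /ratpoly_eval rmorphD hornerD. Qed.

Lemma ratpoly_evalM p q : ratpoly_eval (p * q) = ratpoly_eval p * ratpoly_eval q.
Proof. by rewrite /ratpoly_eval rmorphM hornerM. Qed.

Lemma ratpoly_eval1 : ratpoly_eval 1 = 1.
Proof. by rewrite /ratpoly_eval rmorph1 hornerC. Qed.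

Lemma ratpoly_eval_neq0 p : ratpoly_eval p != 0 -> p%:F != 0.
Proof.
by rewrite tofrac_eq0; apply: contraNneq => ->; rewrite /ratpoly_eval rmorph0 horner0.
Qed.

Lemma evals_poly p : evals p%:F (ratpoly_eval p).
Proof. by exists p, 1; rewrite ratpoly_eval1 tofrac1 !divr1 oner_neq0. Qed.

Lemma evalsD x y u v : evals x u -> evals y v -> evals (x + y) (u + v).
Proof.
move=> [N [D [D0 -> ->]]] [N' [D' [D0' -> ->]]].
exists (N * D' + N' * D), (D * D'); rewrite ratpoly_evalM mulf_neq0 //.
split=> //; first by rewrite addf_div ?ratpoly_eval_neq0 // tofracD !tofracM.
by rewrite addf_div // ratpoly_evalD !ratpoly_evalM.
Qed.

Lemma evalsM x y u v : evals x u -> evals y v -> evals (x * y) (u * v).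
Proof.
move=> [N [D [D0 -> ->]]] [N' [D' [D0' -> ->]]].
exists (N * N'), (D * D'); rewrite !ratpoly_evalM mulf_neq0 //.
by rewrite !tofracM !mulf_div.
Qed.

Lemma evalsV x u : evals x u -> u != 0 -> evals x^-1 u^-1.
Proof.
move=> [N [D [D0 -> ->]]]; rewrite mulf_eq0 invr_eq0 negb_or => /andP[N0 _].
by exists D, N; rewrite !invf_div.
Qed.

Lemma evals_int (m : int) : evals m%:~R m%:~R.
Proof.
have := evals_poly m%:~R; congr evals; first by rewrite rmorph_int.
by rewrite /ratpoly_eval rmorph_int -(rmorph_int polyC) hornerC.
Qed.

Lemma evals0 : evals 0 0. Proof. exact: (evals_int 0). Qed.
Lemma evals1 : evals 1 1. Proof. exact: (evals_int 1). Qed.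

Lemma evalsN x u : evals x u -> evals (- x) (- u).
Proof.
move=> xu; rewrite -mulN1r -[- u]mulN1r.
by apply: evalsM => //; apply: (evals_int (-1)).
Qed.

Lemma evalsB x y u v : evals x u -> evals y v -> evals (x - y) (u - v).
Proof. by move=> xu yv; apply/evalsD/evalsN. Qed.

Lemma evals_div x y u v : evals x u -> evals y v -> v != 0 -> evals (x / y) (u / v).
Proof. by move=> xu yv v0; apply/evalsM/evalsV. Qed.

Lemma evalsX x u k : evals x u -> evals (x ^+ k) (u ^+ k).
Proof.
move=> xu; elim: k => [|k IH]; first exact: evals1.
by rewrite !exprS; apply: evalsM.
Qed.

Lemma evals_sum I (r : seq I) (P : pred I) (F : I -> RF) G :
  (forall i, P i -> evals (F i) (G i)) ->
  evals (\sum_(i <- r | P i) F i) (\sum_(i <- r | P i) G i).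
Proof.
move=> FG.
by apply: (big_ind2 evals) => //; [exact: evals0 | move=> *; exact: evalsD].
Qed.

Lemma evals_prod I (r : seq I) (P : pred I) (F : I -> RF) G :
  (forall i, P i -> evals (F i) (G i)) ->
  evals (\prod_(i <- r | P i) F i) (\prod_(i <- r | P i) G i).
Proof.
move=> FG.
by apply: (big_ind2 evals) => //; [exact: evals1 | move=> *; exact: evalsM].
Qed.

Lemma evals_qv : evals qv z.
Proof. by have := evals_poly 'X; rewrite /ratpoly_eval map_polyX hornerX. Qed.

Lemma evals_qvz (m : int) : z != 0 -> evals (qv ^ m) (z ^ m).
Proof.
move=> z0; case: m => m; first exact/evalsX/evals_qv.
by rewrite !NegzE -!exprnN; apply: evalsV; rewrite ?expf_neq0 //; apply/evalsX/evals_qv.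
Qed.

Lemma evals_poch a b u v r : evals a u -> evals b v -> evals (poch a b r) (poch u v r).
Proof.
move=> au bv; apply: evals_prod => i _; apply: evalsB; first exact: evals1.
by apply/evalsM/evalsX.
Qed.

Definition integral x := exists u, evals x u.

Lemma integralD x y : integral x -> integral y -> integral (x + y).
Proof. by move=> [u xu] [v yv]; exists (u + v); apply: evalsD. Qed.

Lemma integralM x y : integral x -> integral y -> integral (x * y).
Proof. by move=> [u xu] [v yv]; exists (u * v); apply: evalsM. Qed.

Lemma integralN x : integral x -> integral (- x).
Proof. by move=> [u xu]; exists (- u); apply: evalsN. Qed.

Variable e : RF.
Hypothesis ez : evals e 0.

(** In the local ring at z, x is 1 + e k modulo e^2. Thus k acts as a logarithmic derivative:
    products of x correspond to sums of k. *)
Definition first_order (k x : RF) :=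
  integral k /\ exists2 w, integral w & x = 1 + e * (k + e * w).

Lemma first_order_evals k x : first_order k x -> evals x 1.
Proof.
move=> [[u ku] [w [v wv] ->]]; rewrite -[X in evals _ X]addr0.
apply: evalsD; first exact: evals1.
rewrite -[X in evals _ X](mul0r (u + 0 * v)).
by apply: evalsM => //; apply: evalsD => //; apply: evalsM.
Qed.

Lemma first_order1 : first_order 0 1.
Proof. by split; [exists 0; apply: evals0 | exists 0; [exists 0; apply: evals0 | ring]]. Qed.

Lemma first_orderM k l x y :
  first_order k x -> first_order l y -> first_order (k + l) (x * y).
Proof.
have ei : integral e by exists 0.
move=> [ki [w wi ->]] [li [v vi ->]]; split; first exact: integralD.
exists (w + v + (k + e * w) * (l + e * v)); last by ring.
by do ?[apply: integralD | apply: integralM].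
Qed.

Lemma first_orderV k x : first_order k x -> first_order (- k) x^-1.
Proof.
move=> fx; have ei : integral e by exists 0.
have xi : integral x^-1.
  by exists 1^-1; apply: evalsV (oner_neq0 _); apply: first_order_evals fx.
have x0 : x != 0.
  have [N [D [D0 xE /eqP]]] := first_order_evals fx; rewrite eq_sym => /eqP E.
  rewrite xE mulf_neq0 ?invr_neq0 ?ratpoly_eval_neq0 //.
  by apply: contra_eq_neq E => ->; rewrite mul0r eq_sym oner_neq0.
move: fx => [ki [w wi xE]]; split; first exact: integralN.
(* Obtained by solving x (1 - e k) = 1 + e^2 (w - (k + e w) k) for the inverse of x. *)
exists (x^-1 * ((k + e * w) * k - w)).
  by do ?[apply: integralD | apply: integralM | apply: integralN].
apply: (mulfI x0); set y := _ * k - w.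
have -> : x * (1 + e * (- k + e * (x^-1 * y))) = x * (1 - e * k) + e * e * (x * x^-1) * y.
  by ring.
by rewrite mulfV // /y xE; ring.
Qed.

Lemma first_orderXz k x (m : int) : first_order k x -> first_order (m%:~R * k) (x ^ m).
Proof.
move=> fx; have H j : first_order (j%:R * k) (x ^+ j).
  elim: j => [|j IH]; first by rewrite mul0r; apply: first_order1.
  by rewrite exprS -natr1 mulrDl mul1r addrC; apply: first_orderM.
case: m => m; first by rewrite -pmulrn.
by rewrite NegzE -exprnN rmorphN /= mulNr -pmulrn; apply: first_orderV.
Qed.

Lemma first_order_prod r (k x : nat -> RF) :
  (forall j, (j < r)%N -> first_order (k j) (x j)) ->
  first_order (\sum_(j < r) k j) (\prod_(j < r) x j).
Proof.
elim: r => [|r IH] H; first by rewrite !big_ord0; apply: first_order1.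
rewrite !big_ord_recr; apply: first_orderM; last exact: H.
by apply: IH => j jr; apply/H/ltnW.
Qed.
End Evaluation.

(** * The indeterminate q and the relative change of a shifted ratio *)

Lemma qv_neq0 : qv != 0.
Proof. by rewrite tofrac_eq0 polyX_eq0. Qed.

Lemma subr1_exprz_neq0 (K : fieldType) (x : K) (m : int) : x != 0 ->
  (forall k, 1 - x ^+ k.+1 != 0) -> m != 0 -> 1 - x ^ m != 0.
Proof.
move=> x0 H; case: m => [[|m]|m] // _; first exact: H.
rewrite NegzE -exprnN -(mulVf (expf_neq0 m.+1 x0)) -[X in _ - X]mulr1 -mulrBr.
by rewrite mulf_neq0 ?invr_neq0 ?expf_neq0 // -opprB oppr_eq0 H.
Qed.

Lemma qv_not_root (m : int) : m != 0 -> 1 - qv ^ m != 0.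
Proof.
apply: subr1_exprz_neq0 => [|k]; first exact: qv_neq0.
rewrite -tofracXn -tofrac1 -tofracB tofrac_eq0 -size_poly_gt0.
by rewrite -opprB size_polyN size_XnsubC.
Qed.

Lemma wp_ratio0E (K : fieldType) (z : K) d n r :
  wp_ratio z d n 0 r = poch z (z ^+ d) r / poch (z ^+ d) (z ^+ d) r.
Proof. by rewrite /wp_ratio !mul0r oppr0 subr0 addr0 mulr1. Qed.

Lemma first_order_quotient (K : fieldType) (x e c w : K) : 1 - x != 0 ->
  (1 - x * (1 + e * (c + e * w))) / (1 - x) =
  1 + e * (- (c * (x / (1 - x))) + e * - (w * (x / (1 - x)))).
Proof. by move=> x1; field. Qed.

Lemma slope_termE (K : fieldType) (b x y : K) :
  b * - (x + y + 1) = - (b * x) + - - (- b * y) + - b.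
Proof. by ring. Qed.

(** Distributing q^(-bnr) over the r steps makes the relative change a product in which every piece
    tends to 1 as q^n does, so it can be expanded factor by factor. *)
Lemma wp_ratio_quotient (K : fieldType) (q : K) (d n : nat) (b : int) r : q != 0 ->
  (0 < d)%N -> (forall m : int, m != 0 -> 1 - q ^ m != 0) ->
  wp_ratio q d n b r / wp_ratio q d n 0 r =
  \prod_(j < r) ((1 - q ^ (1 + d%:Z * j) * q ^ (b * n)) / (1 - q ^ (1 + d%:Z * j))
     * ((1 - q ^ (d%:Z + d%:Z * j) * q ^ (- (b * n))) / (1 - q ^ (d%:Z + d%:Z * j)))^-1
     * q ^ (- (b * n))).
Proof.
move=> q0 d0 q1; elim: r => [|r IH].
  by rewrite wp_ratio0E /wp_ratio /poch !big_ord0 mulr0 oppr0 !divr1 mulr1.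
rewrite big_ord_recr /= -{}IH !wp_ratio0E /wp_ratio !pochS.
have -> : q ^ (1 + b * n) * q ^+ d ^+ r = q ^ (1 + d%:Z * r) * q ^ (b * n).
  by rewrite expzM_base // -expfzDr //; congr (_ ^ _); ring.
have -> : q ^ (d%:Z - b * n) * q ^+ d ^+ r = q ^ (d%:Z + d%:Z * r) * q ^ (- (b * n)).
  by rewrite expzM_base // -expfzDr //; congr (_ ^ _); ring.
have -> : q * q ^+ d ^+ r = q ^ (1 + d%:Z * r).
  by rewrite -{1}[q]expr1z expzM_base.
have -> : q ^+ d * q ^+ d ^+ r = q ^ (d%:Z + d%:Z * r).
  by rewrite -[RHS]expzM_base.
have -> : q ^ (- (b * n * r.+1)) = q ^ (- (b * n * r)) * q ^ (- (b * n)).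
  by rewrite -expfzDr //; congr (_ ^ _); rewrite -addn1 PoszD; ring.
have n1 : 1 - q ^ (1 + d%:Z * r) != 0 by apply: q1; nia.
have n2 : 1 - q ^ (d%:Z + d%:Z * r) != 0 by apply: q1; nia.
rewrite !invfM !invrK; ring.
Qed.

(** * The summand at a primitive m-th root of unity, treating m = n and m = (d-1) n together *)

Section AtRoot.
Variables (d g n i m : nat) (z : algC).
Hypotheses (d2 : (1 < d)%N) (i0 : (0 < i)%N) (ni : n.+1 = (d * i)%N).
Hypotheses (gd : (2 * g + 3 * d = d * d)%N) (zm : m.-primitive_root z).
Hypotheses (md : coprime m d) (nm : (n <= m)%N) (mN : (m %| d * wp_last d i + 1)%N).

Local Notation N := (wp_last d i).

Lemma last_index_lt : (N < n)%N.
Proof. by rewrite /wp_last; nia. Qed.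

Lemma root_neq0 : z != 0.
Proof.
apply: contra_eq_neq (prim_expr_order zm) => ->.
by rewrite expr0n (gtn_eqF (prim_order_gt0 zm)) eq_sym oner_neq0.
Qed.

Lemma root_last : z ^+ (d * N + 1) = 1.
Proof. by apply/eqP; rewrite -(prim_order_dvd zm). Qed.

Lemma root_base_neq0 k : (0 < k < n)%N -> 1 - z ^+ d ^+ k != 0.
Proof.
move=> /andP[k0 kn]; rewrite subr_eq0 eq_sym -exprM -(prim_order_dvd zm).
by rewrite Gauss_dvdr // gtnNdvd // (leq_trans kn).
Qed.

Lemma root_base_last_neq0 k : (0 < k <= N)%N -> 1 - z ^+ d ^+ k != 0.
Proof. by have := last_index_lt => Nn kN; apply: root_base_neq0; lia. Qed.

Lemma evals_ratio r : (r < n)%N ->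
  evals z (poch qv (qv ^+ d) r / poch (qv ^+ d) (qv ^+ d) r)
          (poch z (z ^+ d) r / poch (z ^+ d) (z ^+ d) r).
Proof.
move=> rn; have qz := evals_qv z; have Qz := evalsX d qz.
apply: evals_div; [exact: evals_poch | exact: evals_poch |].
apply/prodf_neq0 => k _; rewrite -exprS; apply: root_base_neq0.
by have := ltn_ord k; lia.
Qed.

Lemma evals_wp_value r : (r < n)%N -> evals z (wp_value qv d g r) (wp_value z d g r).
Proof.
move=> rn; have qz := evals_qv z; apply: evalsM; last exact: evalsX.
apply: evalsM; last exact/evalsX/evals_ratio.
by apply: evalsB; [exact: evals1 | exact: evalsX].
Qed.

(** Isolates the factor of index N, which vanishes at z and, for x = q, supplies a factor q^n -
    1. *)
Lemma poch_tail (K : fieldType) (x : K) r : (N < r)%N ->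
  poch x (x ^+ d) r = (1 - x ^+ (d * N + 1)) *
    (poch x (x ^+ d) N * poch (x * x ^+ d ^+ N.+1) (x ^+ d) (r - N.+1)).
Proof.
by move=> Nr; rewrite -{1}(subnKC Nr) pochD pochS -exprM -exprS addn1; ring.
Qed.

Lemma ratio_tail r : (N < r)%N -> poch z (z ^+ d) r / poch (z ^+ d) (z ^+ d) r = 0.
Proof. by move=> Nr; rewrite poch_tail // root_last subrr !mul0r. Qed.

Lemma wp_value_tail r : (N < r)%N -> wp_value z d g r = 0.
Proof.
move=> Nr; rewrite /wp_value ratio_tail // expr0n -leqn0 leqNgt (ltnW d2).
by rewrite mulr0 mul0r.
Qed.

Lemma evals_sum_wp_value : (-1) ^+ (d * N) = z ^+ 'C(d * N + 2, 2) ->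
  evals z (\sum_(r < n) wp_value qv d g r) 0.
Proof.
move=> zS; have <- : \sum_(r < n) wp_value z d g r = 0.
  rewrite -(subnKC last_index_lt) big_split_ord /= wp_value_sum //; last 3 first.
  - exact: root_neq0.
  - exact: root_last.
  - exact: root_base_last_neq0.
  rewrite big1 ?addr0 // => r _; apply: wp_value_tail.
  by rewrite ltnS leq_addr.
by apply: evals_sum => r _; apply: evals_wp_value.
Qed.

(** * The case m = n: a second factor q^n - 1 *)

Section SquareFactor.
Hypothesis mn : m = n.

Local Notation e := (qv ^+ n - 1).
Local Notation T r := (wp_value qv d g r).

Lemma evals_uniformizer : evals z e 0.
Proof.
have <- : z ^+ n - 1 = 0 by rewrite -mn (prim_expr_order zm) subrr.
by apply: evalsB (evals1 z); apply: evalsX; apply: evals_qv.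
Qed.

Lemma uniformizer_last : exists2 s, integral z s & 1 - qv ^+ (d * N + 1) = e * s.
Proof.
exists (- \sum_(k < d - 1) qv ^+ n ^+ k).
  apply: integralN; exists (\sum_(k < d - 1) z ^+ n ^+ k).
  by apply: evals_sum => k _; do 2 apply: evalsX; apply: evals_qv.
have -> : (d * N + 1 = n * (d - 1))%N by rewrite /wp_last; nia.
by rewrite exprM mulrN -subrX1 opprB.
Qed.

(** A tail term contains the d-th power of a ratio divisible by e: one copy gives the factor e, and
    the remaining d - 1 > 0 copies make the cofactor vanish at z. *)
Lemma wp_value_tail_uniformizer r : (N < r < n)%N -> exists2 y, evals z y 0 & T r = e * y.
Proof.
move=> /andP[Nr rn]; have := evals_ratio rn; rewrite ratio_tail // => c0.
have [s si sE] := uniformizer_last; have qz := evals_qv z; have Qz := evalsX d qz.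
have [w [v wv] cE] : exists2 w, integral z w &
    poch qv (qv ^+ d) r / poch (qv ^+ d) (qv ^+ d) r = e * w.
  rewrite poch_tail // sE -!mulrA; eexists; last by [].
  apply: integralM => //; apply: integralM; first by eexists; apply: (evals_poch _ qz Qz).
  eexists; apply: evals_div.
  - by apply: (evals_poch _ _ Qz); apply: (evalsM qz); apply: (evalsX _ Qz).
  - by apply: (evals_poch _ Qz Qz).
  - apply/prodf_neq0 => k _; rewrite -exprS; apply: root_base_neq0.
    by have := ltn_ord k; lia.
rewrite /wp_value; set A := 1 - _; set B := qv ^+ (g * r).
have {}Av : evals z A (1 - z ^+ (2 * d * r + 1)).
  by apply: evalsB (evals1 z) _; apply: evalsX.
have Bv : evals z B (z ^+ (g * r)) by apply: evalsX.
exists (w * A * B * (poch qv (qv ^+ d) r / poch (qv ^+ d) (qv ^+ d) r) ^+ (d - 1)).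
  rewrite -[X in evals _ _ X](mulr0 (v * (1 - z ^+ (2 * d * r + 1)) * z ^+ (g * r))).
  apply: evalsM; first by apply: evalsM => //; apply: evalsM.
  have -> : 0 = 0 ^+ (d - 1) :> algC.
    by rewrite expr0n; case: (d - 1)%N (subn_gt0 1 d) => //; rewrite d2.
  exact: evalsX.
move: (poch _ _ _ / _) cE => c cE; have -> : c ^+ d = e * w * c ^+ (d - 1).
  by rewrite -cE -exprS subn1 prednK // ltnW.
rewrite !mulrA [A * e]mulrC -!mulrA; congr (_ * _).
by rewrite [RHS]mulrCA !mulrA [_ * B]mulrAC.
Qed.

(** Since q^n = 1 + e, the power q^(bn) has first-order coefficient b. Every factor of
    [wp_ratio_quotient] is then expanded; its denominators do not vanish at z because r <= N. *)
Lemma first_order_ratio (b : int) r : (r <= N)%N ->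
  first_order z e (b%:~R * wp_slope qv d r) (wp_ratio qv d n b r / wp_ratio qv d n 0 r).
Proof.
move=> rN; have z0 := root_neq0; have ez := evals_uniformizer; have q0 := qv_neq0.
pose k x := qv ^ x / (1 - qv ^ x).
have fb : first_order z e b%:~R (qv ^ (b * n)).
  rewrite mulrC -exprz_exp -[b%:~R]mulr1; apply: (first_orderXz ez b).
  split; first by exists 1; apply: evals1.
  by exists 0; [exists 0; apply: evals0 | rewrite mulr0 addr0 mulr1 addrC subrK].
have fk x (c : RF) (v : RF) : 1 - z ^ x != 0 -> x != 0 -> first_order z e c v ->
    first_order z e (- (c * k x)) ((1 - qv ^ x * v) / (1 - qv ^ x)).
  move=> zx x0 [ci [w wi ->]].
  have ki : integral z (k x).
    by exists (z ^ x / (1 - z ^ x)); apply: evals_div => //;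
       [|apply: evalsB; first exact: evals1]; apply: evals_qvz.
  split; first by apply/integralN/integralM.
  exists (- (w * k x)); first by apply/integralN/integralM.
  exact/first_order_quotient/qv_not_root.
have fN : first_order z e (- b%:~R) (qv ^ (- (b * n))).
  by rewrite -invr_expz; apply: first_orderV.
rewrite (wp_ratio_quotient n b r q0 (ltnW d2) qv_not_root).
rewrite /wp_slope mulr_sumr.
refine (@first_order_prod z e ez r (fun j => b%:~R *
    - (k (1 + d%:Z * j) + k (d%:Z + d%:Z * j) + 1)) (fun j =>
  (1 - qv ^ (1 + d%:Z * j) * qv ^ (b * n)) / (1 - qv ^ (1 + d%:Z * j))
   * ((1 - qv ^ (d%:Z + d%:Z * j) * qv ^ (- (b * n))) / (1 - qv ^ (d%:Z + d%:Z * j)))^-1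
   * qv ^ (- (b * n))) _) => j jr.
rewrite (slope_termE b%:~R (k (1 + d%:Z * j))).
apply: (first_orderM ez _ fN); apply: (first_orderM ez).
  apply: fk fb; last by nia.
  rewrite -expzM_base // expr1z (shift_neq0 root_last root_base_last_neq0) //.
  by lia.
apply: (first_orderV ez); apply: fk fN; last by nia.
by rewrite -expzM_base // -exprS root_base_last_neq0 //; lia.
Qed.

Lemma evals_slope r : (r <= N)%N -> evals z (wp_slope qv d r) (wp_slope z d r).
Proof.
move=> rN; have z0 := root_neq0.
have ev (x : int) : 1 - z ^ x != 0 -> evals z (qv ^ x / (1 - qv ^ x)) (z ^ x / (1 - z ^ x)).
  move=> zx; apply: evals_div zx; first exact: evals_qvz.
  by apply: evalsB (evals1 z) _; apply: evals_qvz.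
apply: evals_sum => j _; have jr := ltn_ord j.
apply/evalsN/evalsD; [apply: evalsD; apply: ev|exact: evals1].
  rewrite -expzM_base // expr1z (shift_neq0 root_last root_base_last_neq0) //.
  by lia.
by rewrite -expzM_base // -exprS root_base_last_neq0 //; lia.
Qed.

(** A perturbation P of total shift c changes the sum, to first order, only through c times the
    slope-weighted sum. *)
Lemma sum_first_order (c : int) (P : nat -> RF) :
  (forall r, (r <= N)%N -> first_order z e (c%:~R * wp_slope qv d r) (P r)) ->
  forall M, (M <= N.+1)%N ->
  exists2 y, evals z y (c%:~R * \sum_(r < M) wp_value z d g r * wp_slope z d r)
  & \sum_(r < M) T r * P r = \sum_(r < M) T r + e * y.
Proof.
move=> HP; elim=> [|M IH] MN.
  exists 0; first by rewrite big_ord0 mulr0; apply: evals0.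
  by rewrite !big_ord0 mulr0 addr0.
have [y yv yE] := IH (ltnW MN); have [_ [w [v wv] PE]] := HP M MN.
have MN' : (M <= N)%N by [].
have Mn : (M < n)%N by have := last_index_lt; lia.
exists (y + T M * (c%:~R * wp_slope qv d M + e * w)).
  rewrite big_ord_recr /= [X in evals _ _ X]mulrDr; apply: (evalsD yv).
  have -> : c%:~R * (wp_value z d g M * wp_slope z d M) =
     wp_value z d g M * (c%:~R * wp_slope z d M + 0 * v) by rewrite mul0r addr0 mulrCA.
  apply: evalsM; first exact: evals_wp_value.
  apply: evalsD; last by apply: evalsM evals_uniformizer _.
  by apply: evalsM (evals_int z c) _; apply: evals_slope.
rewrite !big_ord_recr /= yE PE; move: (T M) (_ + e * w) (\sum_(_ < M) _) => t u s.
by rewrite mulrDr mulr1 mulrDr addrACA (mulrCA t).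
Qed.

Lemma sum_wp_value_tail : exists2 y, evals z y 0 &
  \sum_(r < n) T r = \sum_(r < N.+1) T r + e * y.
Proof.
suff H M : (N.+1 + M <= n)%N -> exists2 y, evals z y 0 &
    \sum_(r < N.+1 + M) T r = \sum_(r < N.+1) T r + e * y.
  by have := H (n - N.+1)%N; rewrite subnKC ?last_index_lt //; apply.
elim: M => [|M IH] Mn.
  by exists 0; [exact: evals0 | rewrite addn0 mulr0 addr0].
have [|y yv yE] := IH; first by lia.
have [|u uv uE] := @wp_value_tail_uniformizer (N.+1 + M); first by lia.
exists (y + u); first by rewrite -[0]addr0; apply: evalsD.
by rewrite addnS big_ord_recr /= yE uE mulrDr addrA.
Qed.

(** As the perturbed sum is 0, the original one is e times the tail cofactor minus the first-order
    term. The latter vanishes at z either because c = 0 or because the values are odd and the slopes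
    even under reversal. *)
Lemma sum_wp_value_uniformizer (c : int) (P : nat -> RF) :
  (forall r, (r <= N)%N -> first_order z e (c%:~R * wp_slope qv d r) (P r)) ->
  \sum_(r < N.+1) T r * P r = 0 ->
  (c = 0) \/ ((-1) ^+ (d * N) = z ^+ 'C(d * N + 2, 2)) ->
  exists2 y, evals z y 0 & \sum_(r < n) T r = e * y.
Proof.
move=> HP S0 hc; have [y yv yE] := sum_first_order HP (leqnn _).
have [u uv uE] := sum_wp_value_tail.
exists (u - y); last first.
  by rewrite uE mulrBr addrC; congr (_ + _); apply/eqP; rewrite -addr_eq0 -yE S0.
rewrite -[X in evals _ _ X](subr0 0); apply: evalsB => //; move: yv.
case: hc => [->|zS]; first by rewrite mul0r.
rewrite wp_value_slope_sum ?mulr0 //; first exact: root_neq0.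
  exact: root_last.
exact: root_base_last_neq0.
Qed.
End SquareFactor.
End AtRoot.

(** * From values at a root of unity to cyclotomic congruences *)

(** [Phi m] is the minimal polynomial of z over the rationals, so a single root decides
    divisibility. *)
Lemma Phi_dvdp m (z : algC) (p : {poly rat}) : m.-primitive_root z ->
  (Phi m %| p) = (ratpoly_eval z p == 0).
Proof.
move=> zm; have [q [qE _ qP]] := minCpolyP z.
suff -> : Phi m = q by rewrite -qP.
apply: (map_poly_inj (ratr : {rmorphism rat -> algC})).
rewrite -qE (minCpoly_cyclotomic zm) -(Cintr_Cyclotomic zm) -map_poly_comp.
by apply: eq_map_poly => a /=; rewrite ratr_int.
Qed.

Lemma root_Phi m (z : algC) : (0 < m)%N ->
  (ratpoly_eval z (Phi m) == 0) = m.-primitive_root z.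
Proof.
move=> /C_prim_root_exists[x xm]; rewrite -(root_cyclotomic xm) -(Cintr_Cyclotomic xm).
rewrite /ratpoly_eval /Phi -map_poly_comp (eq_map_poly (g := intr)) // => a /=.
exact: ratr_int.
Qed.

Lemma coprimep_Phi m (z : algC) (p : {poly rat}) : m.-primitive_root z ->
  ratpoly_eval z p != 0 -> coprimep p (Phi m).
Proof.
move=> zm pz; rewrite -(coprimep_map (ratr : {rmorphism rat -> algC})).
apply/Pdiv.ClosedField.coprimepP => x px; apply: contra pz => Phix.
have xm : m.-primitive_root x by rewrite -root_Phi ?(prim_order_gt0 zm).
by rewrite -(Phi_dvdp p zm) (Phi_dvdp p xm).
Qed.

Lemma congr0_Phi m (z : algC) x :
  m.-primitive_root z -> evals z x 0 -> congr0 x (Phi m).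
Proof.
move=> zm [N [D [D0 -> /esym/eqP ND]]]; exists N, D.
rewrite mulf_eq0 invr_eq0 (negPf D0) orbF in ND.
split=> //; last by rewrite (Phi_dvdp _ zm).
  by have := ratpoly_eval_neq0 D0; rewrite tofrac_eq0.
exact: coprimep_Phi zm D0.
Qed.

Lemma congr0_Phi_sqr n (z : algC) x : n.-primitive_root z ->
  evals z x 0 -> congr0 ((qv ^+ n - 1) * x) (Phi n ^+ 2).
Proof.
move=> zn [N [D [D0 -> /esym/eqP ND]]]; exists (('X^n - 1) * N), D.
rewrite mulf_eq0 invr_eq0 (negPf D0) orbF in ND.
split.
- by have := ratpoly_eval_neq0 D0; rewrite tofrac_eq0.
- exact/coprimep_expr/(coprimep_Phi zn).
- by rewrite tofracM tofracB tofrac1 tofracXn mulrA.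
- rewrite expr2; apply: dvdp_mul; rewrite (Phi_dvdp _ zn) //.
  by rewrite /ratpoly_eval rmorphB rmorph1 /= map_polyXn !hornerE (prim_expr_order zn) subrr.
Qed.

(** The two congruences may come with different fractions. In lowest terms N/D, the denominator
    divides both [D1] and [D2], hence is coprime to both moduli, and N inherits both
    divisibilities. *)
Lemma congr0_mul x (P1 P2 : {poly rat}) : coprimep P1 P2 ->
  congr0 x P1 -> congr0 x P2 -> congr0 x (P1 * P2).
Proof.
move=> P12 [N1 [D1 [D10 cD1 xE PN1]]] [N2 [D2 [D20 cD2 xE2 PN2]]].
pose G := gcdp N1 D1; pose N := N1 %/ G; pose D := D1 %/ G.
have G0 : G != 0 by rewrite gcdp_eq0 (negPf D10) andbF.
have NE : N1 = N * G by rewrite divpK // dvdp_gcdl.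
have DE : D1 = D * G by rewrite divpK // dvdp_gcdr.
have D0 : D != 0 by apply: contraNneq D10 => D0; rewrite DE D0 mul0r.
have cND : coprimep N D by apply: coprimep_div_gcd; rewrite D10 orbT.
have xE' : x = N%:F / D%:F.
  by rewrite xE NE DE !tofracM -mulf_div divff ?mulr1 // tofrac_eq0.
have E : N * D2 = N2 * D.
  apply/eqP; rewrite -tofrac_eq !tofracM -eqr_div ?tofrac_eq0 //.
  by rewrite -xE' -xE2.
have DD2 : D %| D2.
  by rewrite -(Gauss_dvdpr _ (_ : coprimep D N)) ?E ?dvdp_mulIr // coprimep_sym.
have cDP1 : coprimep D P1 by apply: coprimep_dvdr cD1; rewrite DE dvdp_mulIl.
have cDP2 : coprimep D P2 by apply: coprimep_dvdr cD2.
exists N, D; split => //; first by rewrite coprimepMr cDP1.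
rewrite Gauss_dvdp //; apply/andP; split.
  rewrite -(Gauss_dvdpl _ (_ : coprimep P1 G)) -?NE // coprimep_sym.
  by apply: coprimep_dvdr cD1; rewrite dvdp_gcdr.
rewrite -(Gauss_dvdpl _ (_ : coprimep P2 D2)) ?E ?dvdp_mulr //.
by rewrite coprimep_sym.
Qed.

(** For D even the binomial is a multiple of D + 1. For D odd it is (D+1)/2 times the odd number D +
    2, and z^((D+1)/2) = -1 by primitivity. *)
Lemma sign_binomial (z : algC) D :
  (D.+1).-primitive_root z -> (-1) ^+ D = z ^+ 'C(D + 2, 2).
Proof.
move=> zD; have C2 : ('C(D + 2, 2) * 2 = (D + 2) * (D + 1))%N.
  by rewrite addn2 addn1 bin2_double.
case: (boolP (odd D)) => oD; last first.
  have -> : 'C(D + 2, 2) = (D.+1 * (D./2 + 1))%N by nia.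
  by rewrite exprM (prim_expr_order zD) expr1n -signr_odd (negPf oD).
have hE : D = (2 * D./2 + 1)%N by lia.
have -> : 'C(D + 2, 2) = ((D./2 + 1) * (D + 2))%N by nia.
suff zh : z ^+ (D./2 + 1) = -1.
  by rewrite exprM zh exprD -signr_odd oD sqrrN expr1n mulr1.
have /eqP : (z ^+ (D./2 + 1)) ^+ 2 = 1.
  by rewrite -exprM (_ : (_ * 2)%N = D.+1) ?(prim_expr_order zD) //; lia.
rewrite sqrf_eq1 => /orP[|/eqP //]; rewrite -(prim_order_dvd zD).
by rewrite gtnNdvd //; lia.
Qed.

(** Multiplying by relative changes replaces h + 2 of the k + h + 2 equal ratios c by shifted
    ones. *)
Lemma perturbed_termE (K : fieldType) (A B c u v w : K) k h : c != 0 ->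
  A * c ^+ (k + h + 2) * B * (u / c * (v / c) ^+ h * (w / c)) =
  A * B * (c ^+ k * v ^+ h * w * u).
Proof.
move=> c0; rewrite !exprD expr_div_n; have := expf_neq0 h c0.
by move: (c ^+ h) (v ^+ h) (c ^+ k) => x y t x0; field; rewrite c0 x0.
Qed.

Lemma half_weight d g r : (2 * g + 3 * d = d * d)%N ->
  ((d * (d - 3) * r)./2 = g * r)%N.
Proof.
move=> gd; have -> : (d * (d - 3) = g.*2)%N by rewrite mulnBr; lia.
by rewrite -doubleMl doubleK.
Qed.

(** * Choice of shifts and assembly of the two congruences *)

Section Main.
Variables (d g n i : nat).
Hypotheses (d4 : (4 <= d)%N) (i0 : (0 < i)%N) (ni : n.+1 = (d * i)%N).
Hypothesis gd : (2 * g + 3 * d = d * d)%N.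

Local Notation N := (wp_last d i).
Local Notation S := (\sum_(r < n) wp_value qv d g r).

Lemma wp_ratio0_neq0 r : wp_ratio qv d n 0 r != 0.
Proof.
have H k : 1 - qv ^+ k.+1 != 0 by apply: (qv_not_root (m := k.+1)).
rewrite wp_ratio0E mulf_neq0 ?invr_neq0 //; apply/prodf_neq0 => k _.
  by rewrite -exprM -exprS.
by rewrite -exprS -exprM -(prednK (ltnW (ltnW (ltnW d4)))) mulSn H.
Qed.

Lemma sum_wp_value_sqr (z : algC) : n.-primitive_root z ->
  exists2 y, evals z y 0 & S = (qv ^+ n - 1) * y.
Proof.
move=> zn; have dn : coprime n d.
  rewrite coprime_sym; apply: (coprime_dvdl (dvdn_mulr i (dvdnn d))).
  by rewrite -ni coprime_sym coprimenS.
have nN : (n %| d * N + 1)%N.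
  have -> : (d * N + 1 = n * (d - 1))%N by rewrite /wp_last; nia.
  exact: dvdn_mulr.
have d2 : (1 < d)%N by lia.
have ez := evals_uniformizer zn erefl.
have fo := first_order_ratio d2 i0 ni gd zn dn (leqnn n) nN erefl.
pose rho b r := wp_ratio qv d n b r / wp_ratio qv d n 0 r.
(* Of the d ratios, k stay unshifted, h are shifted by 1, one by b and one by -(d-1). Below, b = 0
   for d even, and b = h + 2 for d odd makes the total shift 0. *)
suff [h [k [b [hk hc hS]]]] : exists h k : nat, exists b : int,
  [/\ d = (k + h + 2)%N, - (d - 1)%N%:Z + h%:Z + b = 0 \/ ~~ odd d &
  \sum_(r < N.+1) (1 - qv ^+ (2 * d * r + 1)) * qv ^+ (g * r) *
    (wp_ratio qv d n 0 r ^+ k * wp_ratio qv d n 1 r ^+ h * wp_ratio qv d n b r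
     * wp_ratio qv d n (- (d - 1)%N%:Z) r) = 0].
  apply: (sum_wp_value_uniformizer d2 i0 ni gd zn dn (leqnn n) nN erefl
    (c := - (d - 1)%N%:Z + h%:Z + b)
    (P := fun r => rho (- (d - 1)%N%:Z) r * rho 1 r ^+ h * rho b r)).
  - move=> r rN; rewrite !intrD !mulrDl.
    apply: (first_orderM ez _ (fo b r rN)).
    apply: (first_orderM ez (fo _ r rN)).
    by have := first_orderXz ez h (fo 1 r rN); rewrite mul1r.
  - rewrite -[RHS]hS; apply: eq_bigr => r _; rewrite /wp_value -(wp_ratio0E _ _ n).
    have -> : wp_ratio qv d n 0 r ^+ d = wp_ratio qv d n 0 r ^+ (k + h + 2).
      by rewrite -hk.
    by rewrite /rho perturbed_termE ?wp_ratio0_neq0.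
  - case: hc => [|d_even]; [by left | right].
    (* With dN even, the binomial is (dN + 1)(dN/2 + 1), a multiple of n, so both sides of the sign
       condition are 1. *)
    have dN_even : ~~ odd (d * N) by rewrite oddM (negPf d_even).
    rewrite -signr_odd (negPf dN_even) expr0.
    have C2 : ('C(d * N + 2, 2) * 2 = (d * N + 2) * (d * N + 1))%N.
      by rewrite addn2 addn1 bin2_double.
    have /dvdnP[k' ->] : (n %| 'C(d * N + 2, 2))%N.
      apply: dvdn_trans nN _; apply/dvdnP; exists ((d * N)./2 + 1)%N.
      by move: dN_even C2; move: (d * N)%N => D; nia.
    by rewrite mulnC exprM (prim_expr_order zn) expr1n.
have [h [h0 hd]] : exists h, (0 < h)%N /\ (d = 2 * h + 2 \/ d = 2 * h + 3)%N.
  by exists ((d - 2)./2); lia.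
case: hd => hd.
  exists h, h, 0; split; [by lia | by right; lia |].
  rewrite -[RHS](wp_sum_even qv_neq0 qv_not_root (ltnW (ltnW d4)) i0 ni h0 hd).
  apply: eq_bigr => r _; rewrite (half_weight _ gd) exprSr; congr (_ * (_ * _)).
  by rewrite mulrAC.
exists h, h.+1, h.+2; split; [by lia | by left; lia |].
rewrite -[RHS](wp_sum_odd qv_neq0 qv_not_root (ltnW (ltnW d4)) i0 ni h0 hd).
by apply: eq_bigr => r _; rewrite (half_weight _ gd).
Qed.

(** The order (d-1) n is exactly dN + 1, so [sign_binomial] gives the sign condition and oddness
    alone makes the sum vanish. *)
Lemma evals_sum_last (z : algC) : (d * n - n).-primitive_root z -> evals z S 0.
Proof.
move=> zm; have mE : (d * n - n = (d * N).+1)%N by rewrite /wp_last; nia.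
apply: (evals_sum_wp_value _ i0 ni gd zm) => //.
- by lia.
- rewrite mE coprime_sym; apply: (coprime_dvdl (dvdn_mulr N (dvdnn d))).
  by rewrite coprimenS.
- by nia.
- by rewrite mE addn1.
- by apply: sign_binomial; rewrite -mE.
Qed.
End Main.

Theorem theorem4 (d n : nat) :
  (4 <= d)%N -> (0 < n)%N -> (n.+1 = 0 %[mod d])%N ->
  congr0
    (\sum_(k < n)
        qint (2 * d * k + 1)
        * (qpoch qv (qv ^+ d) k) ^+ d / (qpoch (qv ^+ d) (qv ^+ d) k) ^+ d
        * qv ^+ ((d * (d - 3) * k)./2))
    (Phi n ^+ 2 * Phi (d * n - n)).
Proof.
move=> d4 n0 nd.
have /dvdnP[i ni] : (d %| n.+1)%N by rewrite /dvdn nd mod0n.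
rewrite mulnC in ni.
have i0 : (0 < i)%N by case: i ni => //; rewrite muln0.
(* g is d(d-3)/2, an integer for either parity of d. *)
have [g gd] : exists g, (2 * g + 3 * d = d * d)%N.
  have := odd_double_half d; case: odd => /=; move: d./2 => k dk.
    by exists ((2 * k + 1) * (k - 1))%N; nia.
  by exists (k * (2 * k - 3))%N; nia.
have -> : \sum_(k < n) qint (2 * d * k + 1)
        * (qpoch qv (qv ^+ d) k) ^+ d / (qpoch (qv ^+ d) (qv ^+ d) k) ^+ d
        * qv ^+ ((d * (d - 3) * k)./2)
   = (1 - qv)^-1 * \sum_(r < n) wp_value qv d g r.
  rewrite mulr_sumr; apply: eq_bigr => r _; rewrite /qint /wp_value.
  rewrite (half_weight _ gd) expr_div_n -[(1 - _) / _]mulrC -!mulrA.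
  by [].
have ev m (z : algC) : (1 < m)%N -> m.-primitive_root z -> evals z (1 - qv)^-1 (1 - z)^-1.
  move=> m1 zm; apply: evalsV; first by apply: evalsB (evals1 z) (evals_qv z).
  rewrite subr_eq0 eq_sym -[z]expr1 -(prim_order_dvd zm) dvdn1.
  by rewrite gtn_eqF.
have n1 : (1 < n)%N by nia.
have m1 : (1 < d * n - n)%N by nia.
have [z zn] := C_prim_root_exists n0.
have [z' zm] := C_prim_root_exists (ltnW m1).
apply: congr0_mul.
(* A common root would have order (d-1) n dividing n, impossible as (d-1) n > n. *)
- apply: coprimep_expl; rewrite coprimep_sym; apply: (coprimep_Phi zn).
  rewrite root_Phi; last exact: ltnW.
  apply/negP => zm'; have : (d * n - n %| n)%N.
    by rewrite (prim_order_dvd zm') (prim_expr_order zn).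
  by move/dvdn_leq => /(_ n0); nia.
- have [y yv ->] := sum_wp_value_sqr d4 i0 ni gd zn.
  rewrite mulrCA; apply: (congr0_Phi_sqr zn).
  by rewrite -(mulr0 (1 - z)^-1); apply: evalsM yv; apply: (ev _ _ n1 zn).
- apply: (congr0_Phi zm); rewrite -(mulr0 (1 - z')^-1).
  by apply: evalsM (evals_sum_last d4 i0 ni gd zm); apply: (ev _ _ m1 zm).
Qed.
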